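(* Suppose $f=\frac1n\sum_{i=1}^n f_i$ is $\mu$-strongly convex and each $f_i$ has $L$-Lipschitz continuous gradient; let $\kappa=\frac L\mu$ and $n_c\ge1$. Let $$A(n_c)=\begin{bmatrix} 1-\alpha\mu & \frac{\alpha L}{\sqrt n} & 0\\ 0 & \beta_1^{n_c} & \alpha\beta_2^{n_c}\\ \sqrt n\,\alpha\beta_4^{n_c}L^2 & \beta_4^{n_c}L\left(\|\mathbf{Z}_1^{n_c}-I_{nd}\|_2+\alpha L\right) & \beta_3^{n_c}+\alpha\beta_4^{n_c}L\end{bmatrix}.$$ If the matrix $A(n_c)$ is irreducible and $0<\alpha\le\frac1L$, then $$\rho(A(n_c))\le\lambda_u=\max\left\{1-\frac{\alpha\mu}{2},\ \hat\lambda+\sqrt{2\alpha L\kappa\beta_2^{n_c}\beta_4^{n_c}}\right\},$$ where $$\hat\lambda=\frac{\beta_1^{n_c}+\beta_3^{n_c}+L\alpha\beta_4^{n_c}+\sqrt{\left(\beta_1^{n_c}-\beta_3^{n_c}-L\alpha\beta_4^{n_c}\right)^2+4\beta_2^{n_c}\beta_4^{n_c}L^2\alpha^2+8L\alpha\beta_2^{n_c}\beta_4^{n_c}}}{2}.$$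
   Context: $f_i:\mathbb{R}^d\to\mathbb{R}$, $i=1,\dots,n$, are differentiable. $\mu$-strong convexity ($\mu>0$): $f(z')\ge f(z)+\langle\nabla f(z),z'-z\rangle+\frac{\mu}{2}\|z'-z\|_2^2$ for all $z,z'$. $L$-Lipschitz gradients: $\|\nabla f_i(z)-\nabla f_i(z')\|_2\le L\|z-z'\|_2$ for all $z,z'$ and all $i$. $\rho(\cdot)$ denotes spectral radius. The $n$ nodes form a connected undirected network with edge set $\mathcal{E}$. A communication matrix $\mathbf{U}\in\mathbb{R}^{n\times n}$ is symmetric, doubly stochastic, with $u_{ii}>0$, $u_{ij}\ge0$ for $i\ne j$, $(i,j)\in\mathcal{E}$, and $u_{ij}=0$ for $i\ne j$, $(i,j)\notin\mathcal{E}$. $\mathbf{W}_1,\dots,\mathbf{W}_4$ are communication matrices, $\mathbf{Z}_i=\mathbf{W}_i\otimes I_d$, and $\beta_i=\|\mathbf{W}_i-\frac{1_n1_n^T}{n}\|_2\in[0,1]$, with $\beta_i^{n_c}=\|\mathbf{W}_i^{n_c}-\frac{1_n1_n^T}{n}\|_2$. The matrix $A(n_c)$ governs the error of the gradient tracking iteration with one computation step ($n_g=1$) and $n_c$ communication steps per iteration and step size $\alpha$: $\mathbf{x}_{k+1}=\mathbf{Z}_1^{n_c}\mathbf{x}_k-\alpha\mathbf{Z}_2^{n_c}\mathbf{y}_k$, $\mathbf{y}_{k+1}=\mathbf{Z}_3^{n_c}\mathbf{y}_k+\mathbf{Z}_4^{n_c}(\nabla\mathbf{f}(\mathbf{x}_{k+1})-\nabla\mathbf{f}(\mathbf{x}_k))$,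 where $\nabla\mathbf{f}(\mathbf{x})=(\nabla f_1(x_1),\dots,\nabla f_n(x_n))$. *)

(* Defs.v *)
From mathcomp Require Import all_boot all_order all_algebra all_fingroup.
From mathcomp Require Import all_classical all_reals all_analysis.
From mathcomp Require Import complex mxtens.

Set Implicit Arguments.
Unset Strict Implicit.
Unset Printing Implicit Defensive.

Import Order.TTheory GRing.Theory Num.Theory.
Import numFieldNormedType.Exports.

Local Open Scope classical_set_scope.
Local Open Scope ring_scope.

Section Euclidean.
Variable R : realType.

Definition dotv d (u v : 'cV[R]_d) : R := \sum_(i < d) u i 0 * v i 0.

(* The library norm `|x| on 'cV[R]_d is the sup norm, hence the explicit
   Euclidean norm. *)
Definition l2norm d (u : 'cV[R]_d) : R := Num.sqrt (\sum_(i < d) u i 0 ^+ 2).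

(* The matrix norm induced by l2norm. *)
Definition norm2_mx n (A : 'M[R]_n) : R :=
  sup [set l2norm (A *m x) | x in [set x : 'cV[R]_n | l2norm x <= 1]].

(* Meaningful when f is differentiable at z. *)
Definition grad d (f : 'cV[R]_d -> R) (z : 'cV[R]_d) : 'cV[R]_d :=
  \col_(i < d) 'D_(delta_mx i 0) f z.

Definition strongly_convex d (mu : R) (f : 'cV[R]_d -> R) : Prop :=
  forall z z', f z' >= f z + dotv (grad f z) (z' - z)
                       + mu / 2 * l2norm (z' - z) ^+ 2.

Definition lipschitz_grad d (L : R) (f : 'cV[R]_d -> R) : Prop :=
  forall z z', l2norm (grad f z - grad f z') <= L * l2norm (z - z').

Definition avg n d (f : 'I_n -> 'cV[R]_d -> R) : 'cV[R]_d -> R :=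
  fun z => n%:R^-1 * \sum_(i < n) f i z.

End Euclidean.

Section Matrices.
Variable R : realType.

(* Complex eigenvalues are used, so that rho is the usual spectral radius of a
   real matrix; the supremum is a maximum for n >= 1 (finite nonempty set). *)
Definition spectral_radius n (A : 'M[R]_n) : R :=
  sup [set ComplexField.Normc.normc z |
        z in [set z : R[i] | eigenvalue (map_mx (real_complex R) A) z]].

(* Some simultaneous permutation of rows and columns puts A in the block form
   [B, C; 0, D] with square diagonal blocks of sizes r and n - r, both > 0. *)
Definition reducible_mx n (A : 'M[R]_n) : Prop :=
  exists (s : 'S_n) (r : nat), (0 < r < n)%N /\
    forall i j : 'I_n, (r <= i)%N -> (j < r)%N ->
      (perm_mx s *m A *m (perm_mx s)^T) i j = 0.

Definition irreducible_mx n (A : 'M[R]_n) : Prop := ~ reducible_mx A.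

End Matrices.

Section GradientTracking.
Variable R : realType.

Definition connected_network n (E : rel 'I_n) : Prop :=
  symmetric E /\ forall i j : 'I_n, connect E i j.

Record communication_matrix n (E : rel 'I_n) (U : 'M[R]_n) : Prop := {
  comm_sym : U^T = U;
  comm_row_sum : forall i, \sum_(j < n) U i j = 1;
  comm_col_sum : forall j, \sum_(i < n) U i j = 1;
  comm_diag : forall i, 0 < U i i;
  comm_edge : forall i j, i != j -> E i j -> 0 <= U i j;
  comm_non_edge : forall i j, i != j -> ~~ E i j -> U i j = 0 }.

(* The constant matrix is 1 1^T / n, the averaging projector. *)
Definition beta n (W : 'M[R]_n) : R := norm2_mx (W - const_mx n%:R^-1).

Definition lift_comm n d (W : 'M[R]_n) : 'M[R]_(n * d) := W *t (1%:M : 'M[R]_d).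

Definition A_mx n d (alpha mu L : R) (W1 W2 W3 W4 : 'M[R]_n) (nc : nat)
    : 'M[R]_3 :=
  let b1 := beta W1 ^+ nc in let b2 := beta W2 ^+ nc in
  let b3 := beta W3 ^+ nc in let b4 := beta W4 ^+ nc in
  let sqrtn := Num.sqrt (n%:R : R) in
  let Z1 := lift_comm d W1 in
  \matrix_(i < 3, j < 3)
    nth 0 (nth [::]
      [:: [:: 1 - alpha * mu; alpha * L / sqrtn; 0];
          [:: 0; b1; alpha * b2];
          [:: sqrtn * alpha * b4 * L ^+ 2;
              b4 * L * (norm2_mx (Z1 ^+ nc - 1%:M) + alpha * L);
              b3 + alpha * b4 * L]] i) j.

Definition lambda_hat n (alpha L : R) (W1 W2 W3 W4 : 'M[R]_n) (nc : nat) : R :=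
  let b1 := beta W1 ^+ nc in let b2 := beta W2 ^+ nc in
  let b3 := beta W3 ^+ nc in let b4 := beta W4 ^+ nc in
  (b1 + b3 + L * alpha * b4
   + Num.sqrt ((b1 - b3 - L * alpha * b4) ^+ 2
               + 4 * b2 * b4 * L ^+ 2 * alpha ^+ 2
               + 8 * L * alpha * b2 * b4)) / 2.

Definition lambda_u n (alpha mu L : R) (W1 W2 W3 W4 : 'M[R]_n) (nc : nat) : R :=
  let kappa := L / mu in
  Num.max (1 - alpha * mu / 2)
    (lambda_hat alpha L W1 W2 W3 W4 nc
     + Num.sqrt (2 * alpha * L * kappa * beta W2 ^+ nc * beta W4 ^+ nc)).

End GradientTracking.

(* Main.v *)
Require Import Defs.
From mathcomp Require Import all_boot all_order all_algebra all_fingroup.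
From mathcomp Require Import all_classical all_reals all_analysis.
From mathcomp Require Import complex mxtens.
From mathcomp Require Import ring lra.
Import Order.TTheory GRing.Theory Num.Theory.
Import numFieldNormedType.Exports.
Local Open Scope ring_scope.

(** The bound holds because no complex number z with t = |z| above lambda_u can
be an eigenvalue of the nonnegative matrix A(n_c).

Taking moduli in a left eigenvector v of A gives real nonnegative weights
w = |v|, not all zero, with t * w <= w * A (nonneg_eigenvalue_subinvariant).
Entries (0, 2) and (1, 0) of A vanish, so these three inequalities can be
eliminated cyclically (cyclic_subinvariant_eq0): they force w = 0 as soon
as the characteristic polynomial is positive at t, that is
  alpha^3 L^3 b2 b4 < (t - (1 - alpha mu)) * q(t),
  q(t) = (t - b1) (t - b3 - alpha L b4) - alpha L (s + alpha L) b2 b4,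
where b_i = beta_i^n_c and s = |Z_1^n_c - I|.

The two members of the maximum lambda_u control one factor each.  The first
gives t - (1 - alpha mu) > alpha mu / 2.  For the second, s <= 2 makes q(t) at
least its value with s replaced by 2, and the larger root of that quadratic
is lambda_hat; hence q(t) >= (t - lambda_hat)^2 > 2 alpha L kappa b2 b4
(quadratic_gt).  The product exceeds (alpha L)^2 b2 b4, which dominates
(alpha L)^3 b2 b4 as alpha L <= 1.

Two facts come from the setting.  The bound s <= 2 holds because a doubly
stochastic matrix is a Euclidean contraction, by Jensen's inequality, and Z_1
inherits double stochasticity from W_1.  The inequality mu <= L, which makes
the entry 1 - alpha mu nonnegative, follows by comparing the gradients of the
average function at two points. *)

(** * The Euclidean norm and its induced matrix norm *)

Lemma sqr_l2norm {R : realType} {m} (u : 'cV[R]_m) :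
  l2norm u ^+ 2 = \sum_(i < m) u i 0 ^+ 2.
Proof. by rewrite sqr_sqrtr // sumr_ge0 // => i _; apply: sqr_ge0. Qed.

Lemma l2norm_ge0 {R : realType} {m} (u : 'cV[R]_m) : 0 <= l2norm u.
Proof. exact: sqrtr_ge0. Qed.

Lemma ler_l2norm {R : realType} {m p} (u : 'cV[R]_m) (v : 'cV[R]_p) :
  (l2norm u <= l2norm v) = (\sum_i u i 0 ^+ 2 <= \sum_i v i 0 ^+ 2).
Proof.
by rewrite -[LHS]ler_sqr ?nnegrE ?l2norm_ge0 // !sqr_l2norm.
Qed.

Lemma ler_coord_l2norm {R : realType} {m} (u : 'cV[R]_m) (i : 'I_m) :
  `|u i 0| <= l2norm u.
Proof.
rewrite -[_ <= _]ler_sqr ?nnegrE ?l2norm_ge0 // sqr_l2norm real_normK ?num_real //.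
by rewrite (bigD1 i) //= lerDl sumr_ge0 // => j _; apply: sqr_ge0.
Qed.

Lemma l2norm_delta {R : realType} {m} (i : 'I_m) :
  l2norm (delta_mx i 0 : 'cV[R]_m) = 1.
Proof.
rewrite /l2norm (bigD1 i) //= big1 => [|j ji]; last first.
  by rewrite mxE (negPf ji) /= expr0n.
by rewrite mxE !eqxx expr1n addr0 sqrtr1.
Qed.

(** The parallelogram bound |u - v|^2 <= 2 |u|^2 + 2 |v|^2 replaces the triangle
inequality here: it loses nothing when u and v have the same norm bound. *)
Lemma l2normB_le {R : realType} {m} (r : R) (u v : 'cV[R]_m) :
  l2norm u <= r -> l2norm v <= r -> l2norm (u - v) <= 2 * r.
Proof.
move=> ur vr; have r0 : 0 <= r := le_trans (l2norm_ge0 u) ur.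
have sq_le (w : 'cV[R]_m) : l2norm w <= r -> l2norm w ^+ 2 <= r ^+ 2.
  by move=> wr; rewrite ler_sqr ?nnegrE ?l2norm_ge0.
rewrite -[_ <= _]ler_sqr ?nnegrE ?l2norm_ge0 ?mulr_ge0 //.
have: l2norm (u - v) ^+ 2 <= 2 * l2norm u ^+ 2 + 2 * l2norm v ^+ 2.
  rewrite !sqr_l2norm !mulr_sumr -big_split /= ler_sum // => i _.
  by rewrite !mxE; have := sqr_ge0 (u i 0 + v i 0); nra.
by have := sq_le _ ur; have := sq_le _ vr; nra.
Qed.

Lemma norm2_mx_le {R : realType} {m} (b : R) (M : 'M[R]_m) :
  (forall x, l2norm x <= 1 -> l2norm (M *m x) <= b) -> norm2_mx M <= b.
Proof.
move=> Mb; apply: ge_sup => [|_ [x /= x1 <-]]; last exact: Mb.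
exists (l2norm (M *m 0)), 0 => //=.
by rewrite /l2norm big1 ?sqrtr0 // => i _; rewrite mxE expr0n.
Qed.

(** When the set of norms is unbounded, its supremum is 0 by convention. *)
Lemma norm2_mx_ge0 {R : realType} {m} (M : 'M[R]_m) : 0 <= norm2_mx M.
Proof.
rewrite /norm2_mx; set S := (X in sup X).
have [supS|nsupS] := pselect (has_sup S); last by rewrite sup_out.
have [y [x x1 xy]] := supS.1.
apply: (@le_trans _ _ y); first by rewrite -xy l2norm_ge0.
by apply: ub_le_sup; [exact: supS.2|exists x].
Qed.

(** * Doubly stochastic matrices are contractions *)

Definition doubly_stochastic {R : realType} {m} (M : 'M[R]_m) : Prop :=
  [/\ forall i j, 0 <= M i j, forall i, \sum_j M i j = 1
    & forall j, \sum_i M i j = 1].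

(** The difference of the two sides is the variance of x under the weights w. *)
Lemma jensen_sqr {R : realType} {m} (w x : 'I_m -> R) :
  (forall i, 0 <= w i) -> \sum_i w i = 1 ->
  (\sum_i w i * x i) ^+ 2 <= \sum_i w i * x i ^+ 2.
Proof.
move=> w0 w1; set a := \sum_i _ * _.
have: 0 <= \sum_i w i * (x i - a) ^+ 2.
  by rewrite sumr_ge0 // => i _; rewrite mulr_ge0 // sqr_ge0.
have -> : \sum_i w i * (x i - a) ^+ 2 =
    \sum_i (w i * x i ^+ 2 - (2 * a) * (w i * x i) + a ^+ 2 * w i).
  by apply: eq_bigr => i _; ring.
rewrite big_split sumrB /= -!mulr_sumr w1 -/a.
by nra.
Qed.

(** The row sums give Jensen's inequality in each coordinate; the column sums
then collapse the resulting double sum. *)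
Lemma doubly_stochastic_contraction {R : realType} {m} (M : 'M[R]_m) x :
  doubly_stochastic M -> l2norm (M *m x) <= l2norm x.
Proof.
move=> [M0 Mr Mc]; rewrite ler_l2norm.
apply: (@le_trans _ _ (\sum_i \sum_j M i j * x j 0 ^+ 2)).
  by apply: ler_sum => i _; rewrite mxE; apply: jensen_sqr.
rewrite exchange_big /= ler_sum // => j _.
by rewrite -mulr_suml Mc mul1r.
Qed.

Lemma doubly_stochastic_exp_contraction {R : realType} {m} (M : 'M[R]_m) k x :
  doubly_stochastic M -> l2norm (M ^+ k *m x) <= l2norm x.
Proof.
move=> dsM; elim: k x => [|k IHk] x; first by rewrite expr0 mul1mx.
rewrite exprSr -mulmxE -mulmxA; apply: le_trans (IHk _) _.
exact: doubly_stochastic_contraction.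
Qed.

Lemma norm2_expB1_le2 {R : realType} {m} (M : 'M[R]_m) k :
  doubly_stochastic M -> norm2_mx (M ^+ k - 1%:M) <= 2.
Proof.
move=> dsM; apply: norm2_mx_le => x x1.
rewrite mulmxBl mul1mx -[2]mulr1; apply: l2normB_le => //.
by apply: le_trans x1; apply: doubly_stochastic_exp_contraction.
Qed.

Lemma communication_doubly_stochastic {R : realType} {n} (E : rel 'I_n)
  (W : 'M[R]_n) : communication_matrix E W -> doubly_stochastic W.
Proof.
case=> _ Wr Wc Wd We Wn; split=> // i j.
have [->|ij] := eqVneq i j; first exact: ltW.
by have [/We|/Wn] := boolP (E i j) => ->.
Qed.

Lemma sum_mxtens {R : realType} {n d} (F : 'I_(n * d) -> R) :
  \sum_k F k = \sum_i \sum_j F (mxtens_index (i, j)).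
Proof.
rewrite pair_big /= (reindex (@mxtens_index n d)) /=; last first.
  by exists (@mxtens_unindex n d) => k _; rewrite ?mxtens_indexK ?mxtens_unindexK.
by apply: eq_bigr => -[].
Qed.

Lemma sum_scalar_row {R : realType} {d} (i : 'I_d) :
  \sum_(j < d) (1%:M : 'M[R]_d) i j = 1.
Proof.
rewrite (bigD1 i) //= big1 => [|j ji]; first by rewrite mxE eqxx addr0.
by rewrite mxE eq_sym (negPf ji).
Qed.

Lemma sum_scalar_col {R : realType} {d} (j : 'I_d) :
  \sum_(i < d) (1%:M : 'M[R]_d) i j = 1.
Proof.
by rewrite -[RHS](sum_scalar_row j); apply: eq_bigr => i _; rewrite !mxE eq_sym.
Qed.

Lemma lift_comm_doubly_stochastic {R : realType} {n} d (W : 'M[R]_n) :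
  doubly_stochastic W -> doubly_stochastic (lift_comm d W).
Proof.
move=> [W0 Wr Wc]; split => [k l|k|l].
- case: (mxtens_indexP k) => i a; case: (mxtens_indexP l) => j b.
  by rewrite tensmxE mulr_ge0 // mxE ler0n.
- case: (mxtens_indexP k) => i a; rewrite sum_mxtens -(Wr i).
  apply: eq_bigr => j _; under eq_bigr do rewrite tensmxE.
  by rewrite -mulr_sumr sum_scalar_row mulr1.
- case: (mxtens_indexP l) => j b; rewrite sum_mxtens -(Wc j).
  apply: eq_bigr => i _; under eq_bigr do rewrite tensmxE.
  by rewrite -mulr_sumr sum_scalar_col mulr1.
Qed.

(** * Strong convexity against Lipschitz gradients *)

Lemma grad_avg {R : realType} {n d} (f : 'I_n -> 'cV[R]_d -> R) z :
  (forall i, differentiable (f i) z) ->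
  grad (avg f) z = n%:R^-1 *: \sum_i grad (f i) z.
Proof.
move=> df; apply/colP => k; rewrite !mxE summxE.
have dv i : derivable (f i) z (delta_mx k 0) by apply: diff_derivable.
have -> : avg f = n%:R^-1 \*: (\sum_i f i).
  by apply/funext => x; rewrite /avg /= fct_sumE.
rewrite deriveZ ?derive_sum //; last exact: derivable_sum.
by congr (_ * _); apply: eq_bigr => i _; rewrite mxE.
Qed.

(** Adding the strong convexity inequalities of the average between 0 and a unit
coordinate vector e gives mu <= (grad e - grad 0) . e, an average of quantities
that are each at most L.  A coordinate direction suffices, and for it the
Cauchy-Schwarz inequality is just the bound of a coordinate by the norm. *)
Lemma strong_convexity_le_lipschitz {R : realType} {n d}
    (f : 'I_n -> 'cV[R]_d -> R) (mu L : R) :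
  (0 < n)%N -> (0 < d)%N ->
  (forall i z, differentiable (f i) z) ->
  strongly_convex mu (avg f) -> (forall i, lipschitz_grad L (f i)) -> mu <= L.
Proof.
case: d f => // d f n0 _ df cf lf.
pose e : 'cV[R]_d.+1 := delta_mx 0 0.
have dote (u : 'cV[R]_d.+1) : dotv u e = u 0 0.
  rewrite /dotv (bigD1 0) //= big1 => [|i i0]; last first.
    by rewrite mxE (negPf i0) mulr0.
  by rewrite mxE !eqxx mulr1 addr0.
have dotNe (u : 'cV[R]_d.+1) : dotv u (- e) = - u 0 0.
  by rewrite -dote -sumrN; apply: eq_bigr => i _; rewrite mxE mulrN.
have ne : l2norm e = 1 by apply: l2norm_delta.
have nNe : l2norm (- e) = 1.
  by rewrite -ne; congr Num.sqrt; apply: eq_bigr => i _; rewrite mxE sqrrN.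
have := cf 0 e; have := cf e 0.
rewrite subr0 sub0r dote dotNe ne nNe expr1n => c1 c2.
have mule : mu <= (grad (avg f) e - grad (avg f) 0) 0 0.
  by rewrite [X in _ <= X]mxE [(- grad _ _) _ _]mxE; lra.
apply: le_trans mule _.
rewrite !grad_avg // -scalerBr -sumrB mxE summxE mulrC ler_pdivrMr ?ltr0n //.
apply: (@le_trans _ _ (\sum_(i < n) L)); last first.
  by rewrite sumr_const card_ord mulr_natr.
apply: ler_sum => i _; apply: le_trans (ler_norm _) _.
apply: le_trans (ler_coord_l2norm _ 0) _.
by have := lf i e 0; rewrite subr0 ne mulr1.
Qed.

(** * Eigenvalues of nonnegative matrices *)

Lemma normc_ge0 {R : rcfType} (z : R[i]) : 0 <= ComplexField.Normc.normc z.
Proof. by case: z => a b; apply: sqrtr_ge0. Qed.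

Lemma normc_real {R : rcfType} (a : R) :
  0 <= a -> ComplexField.Normc.normc (real_complex R a) = a.
Proof. by move=> a0; rewrite /= expr0n addr0 sqrtr_sqr ger0_norm. Qed.

Lemma normc_sum {R : rcfType} {n} (F : 'I_n -> R[i]) :
  ComplexField.Normc.normc (\sum_i F i)
    <= \sum_i ComplexField.Normc.normc (F i).
Proof.
elim/big_ind2: _ => [|a u b v au bv|//].
  by rewrite ComplexField.Normc.normc0.
by apply: le_trans (le_normcD _ _) (lerD au bv).
Qed.

(** The weights are the moduli of the entries of a left eigenvector.  This turns
a statement about complex eigenvalues into real linear inequalities. *)
Lemma nonneg_eigenvalue_subinvariant {R : realType} {n} (A : 'M[R]_n) z :
  (forall i j, 0 <= A i j) -> eigenvalue (map_mx (real_complex R) A) z ->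
  exists w : 'I_n -> R, [/\ forall i, 0 <= w i, exists i, 0 < w i &
    forall j, ComplexField.Normc.normc z * w j <= \sum_i w i * A i j].
Proof.
move=> A0 /eigenvalueP[v vA v0].
exists (fun i => ComplexField.Normc.normc (v 0 i)); split=> [i||j].
- exact: normc_ge0.
- case/rV0Pn: v0 => i vi0; exists i; rewrite lt_def normc_ge0 andbT.
  by apply: contra vi0 => /eqP/ComplexField.Normc.eq0_normc ->.
- have := congr1 (fun u : 'rV_n => u 0 j) vA; rewrite !mxE => vAj.
  rewrite -ComplexField.Normc.normcM -vAj.
  apply: le_trans (normc_sum _) _; apply: ler_sum => i _.
  by rewrite ComplexField.Normc.normcM mxE normc_real.
Qed.

(** Nonnegativity of the bound covers the case of an empty spectrum, where the
supremum is 0. *)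
Lemma spectral_radius_le {R : realType} {n} (A : 'M[R]_n) b : 0 <= b ->
  (forall z, eigenvalue (map_mx (real_complex R) A) z ->
     ComplexField.Normc.normc z <= b) -> spectral_radius A <= b.
Proof.
move=> b0 Ab; rewrite /spectral_radius; set S := (X in sup X).
have [->|S0] := eqVneq S set0; first by rewrite sup0.
by apply: ge_sup; [exact/set0P|move=> _ [z /= /Ab zb <-]].
Qed.

(** Bounding y by x and z, then x by z, in the last inequality yields
(a b c - g (q p + a e)) z <= 0; the coefficient is the determinant of the
system, so its positivity forces z = 0 and then x = y = 0. *)
Lemma cyclic_subinvariant_eq0 {R : realFieldType} (a b c x y z p q e g : R) :
  0 < a -> 0 < b -> 0 <= p -> 0 <= q -> 0 <= g -> 0 <= x -> 0 <= y -> 0 <= z ->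
  a * x <= p * z -> b * y <= q * x + e * z -> c * z <= g * y ->
  g * (q * p + a * e) < a * b * c -> [/\ x = 0, y = 0 & z = 0].
Proof.
move=> a0 b0 p0 q0 g0 x0 y0 z0 hx hy hz det.
have haz : a * b * c * z <= g * (q * p + a * e) * z.
  have h1 : a * b * (c * z) <= a * b * (g * y) by rewrite ler_pM2l ?mulr_gt0.
  have h2 : g * a * (b * y) <= g * a * (q * x + e * z).
    by rewrite ler_wpM2l // mulr_ge0 // ltW.
  have h3 : g * q * (a * x) <= g * q * (p * z) by rewrite ler_wpM2l ?mulr_ge0.
  by lra.
have zE : z = 0.
  apply/eqP; rewrite eq_le z0 andbT leNgt; apply/negP => z1.
  by move: haz; rewrite ler_pM2r // leNgt det.
rewrite zE in hx hy *.
have xE : x = 0.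
  by apply/eqP; rewrite eq_le x0 andbT -(pmulr_rle0 _ a0); lra.
by split=> //; apply/eqP; rewrite eq_le y0 andbT -(pmulr_rle0 _ b0) xE in hy *; lra.
Qed.

(** The number (b + c + D) / 2 is the larger root of (t - b) (t - c) - r, and the
other root lies D below it.  So beyond the larger root the quadratic is at
least the square of the distance to that root. *)
Lemma quadratic_gt {R : rcfType} (b c r D S t : R) :
  D = Num.sqrt ((b - c) ^+ 2 + 4 * r) ->
  0 <= r -> 0 <= S -> (b + c + D) / 2 + Num.sqrt S < t ->
  [/\ b < t & S + r < (t - b) * (t - c)].
Proof.
move=> DE r0 S0 ht.
have D0 : 0 <= D by rewrite DE sqrtr_ge0.
have D2 : D ^+ 2 = (b - c) ^+ 2 + 4 * r.
  by rewrite DE sqr_sqrtr // addr_ge0 ?sqr_ge0 ?mulr_ge0.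
have bcD : b - c <= D.
  apply: le_trans (ler_norm _) _; rewrite -ler_sqr ?nnegrE // D2.
  by rewrite real_normK ?num_real // lerDl mulr_ge0.
have S2 := sqr_sqrtr S0; have s0 := sqrtr_ge0 S.
move: ht S2 s0; set s := Num.sqrt S => ht S2 s0.
split; first lra.
(* Distance from t to the larger root. *)
pose h := t - (b + c + D) / 2.
have hs : s ^+ 2 < h ^+ 2 by rewrite ltr_sqr ?nnegrE /h; lra.
have hD : 0 <= h * D by rewrite mulr_ge0 // /h; lra.
have -> : (t - b) * (t - c) = h ^+ 2 + h * D + (D ^+ 2 - (b - c) ^+ 2) / 4.
  by rewrite /h; field.
by rewrite D2; lra.
Qed.

(** The strict inequality says that the characteristic polynomial is positive
at t.  The two zero entries are what make the cyclic elimination available. *)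
Lemma not_eigenvalue_coupled_mx {R : realType} (a b c e g h p : R) (z : R[i])
    (t := ComplexField.Normc.normc z) :
  0 <= a -> 0 <= b -> 0 <= c -> 0 <= e -> 0 <= g -> 0 <= h -> 0 <= p ->
  a < t -> b < t -> g * (c * p + (t - a) * e) < (t - a) * (t - b) * (t - h) ->
  ~~ eigenvalue (map_mx (real_complex R) (\matrix_(i < 3, j < 3)
       nth 0 (nth [::] [:: [:: a; c; 0]; [:: 0; b; g]; [:: p; e; h]] i) j)) z.
Proof.
move=> a0 b0 c0 e0 g0 h0 p0 at_ bt det; apply/negP.
case/nonneg_eigenvalue_subinvariant => [|w [w0 [i wi] wA]].
  by move=> [[|[|[|//]]] ?] [[|[|[|//]]] ?]; rewrite mxE.
pose i0 : 'I_3 := ord0; pose i1 : 'I_3 := lift ord0 ord0.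
pose i2 : 'I_3 := lift ord0 (lift ord0 ord0).
have [w00 w10 w20] : [/\ w i0 = 0, w i1 = 0 & w i2 = 0].
  apply: (@cyclic_subinvariant_eq0 _ (t - a) (t - b) (t - h) _ _ _ p c e g);
    rewrite ?subr_gt0 //.
  - by have := wA i0; rewrite !big_ord_recl big_ord0 !mxE /= -/t; lra.
  - by have := wA i1; rewrite !big_ord_recl big_ord0 !mxE /= -/t; lra.
  - by have := wA i2; rewrite !big_ord_recl big_ord0 !mxE /= -/t; lra.
suff w_eq0 j : w j = 0 by rewrite w_eq0 ltxx in wi.
case: j => -[|[|[|//]]] lt_j3;
  [rewrite -[RHS]w00|rewrite -[RHS]w10|rewrite -[RHS]w20]; congr w;
  exact: val_inj.
Qed.

(** * The spectral radius bound *)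

Theorem theorem7 (R : realType) (n d : nat) (hn : (0 < n)%N) (hd : (0 < d)%N)
    (f : 'I_n -> 'cV[R]_d -> R) (mu L alpha : R) (nc : nat)
    (E : rel 'I_n) (W1 W2 W3 W4 : 'M[R]_n)
    (hdiff : forall (i : 'I_n) (z : 'cV[R]_d), differentiable (f i) z)
    (hmu : 0 < mu)
    (hconv : strongly_convex mu (avg f))
    (hlip : forall i : 'I_n, lipschitz_grad L (f i))
    (hnet : connected_network E)
    (hW1 : communication_matrix E W1)
    (hW2 : communication_matrix E W2)
    (hW3 : communication_matrix E W3)
    (hW4 : communication_matrix E W4)
    (hnc : (1 <= nc)%N)
    (hirr : irreducible_mx (A_mx d alpha mu L W1 W2 W3 W4 nc))
    (halpha : 0 < alpha <= 1 / L) :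
  spectral_radius (A_mx d alpha mu L W1 W2 W3 W4 nc)
    <= lambda_u alpha mu L W1 W2 W3 W4 nc.
Proof.
have muL : mu <= L := strong_convexity_le_lipschitz _ _ _ hn hd hdiff hconv hlip.
have L0 : 0 < L := lt_le_trans hmu muL.
case/andP: halpha => alpha0; rewrite ler_pdivlMr // => alphaL.
have alphamu : alpha * mu <= alpha * L by rewrite ler_pM2l.
have alphamu0 : 0 < alpha * mu by rewrite mulr_gt0.
have s2 : norm2_mx (lift_comm d W1 ^+ nc - 1%:M) <= 2.
  apply/norm2_expB1_le2/lift_comm_doubly_stochastic.
  exact: communication_doubly_stochastic hW1.
have s0 := norm2_mx_ge0 (lift_comm d W1 ^+ nc - 1%:M).
have beta0 (W : 'M[R]_n) : 0 <= beta W ^+ nc by rewrite exprn_ge0 ?norm2_mx_ge0.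
have rn0 : 0 < Num.sqrt (n%:R : R) by rewrite sqrtr_gt0 ltr0n.
rewrite /lambda_u /lambda_hat /A_mx.
move: (beta0 W1) (beta0 W2) (beta0 W3) (beta0 W4) => {beta0}.
move: (beta W1 ^+ nc) (beta W2 ^+ nc) (beta W3 ^+ nc) (beta W4 ^+ nc).
move: (norm2_mx _) (Num.sqrt n%:R) s0 s2 rn0.
move=> s rn s0 s2 rn0 b1 b2 b3 b4 b10 b20 b30 b40.
have b24 : 0 <= b2 * b4 by rewrite mulr_ge0.
have aL0 : 0 < alpha * L by rewrite mulr_gt0.
have [alphaN LN muN rnN] : [/\ 0 <= alpha, 0 <= L, 0 <= mu & 0 <= rn].
  by split; apply: ltW.
apply: spectral_radius_le => [|z].
  by rewrite le_max; apply/orP; left; lra.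
apply: contraLR; rewrite -ltNge gt_max => /andP[].
set t := ComplexField.Normc.normc z => t1 t2.
(* lambda_hat is the larger root of (t - b1) (t - b3 - alpha b4 L) - r, which is
   the characteristic polynomial of the trailing 2 x 2 block for s = 2. *)
pose r := (alpha * L) ^+ 2 * (b2 * b4) + 2 * (alpha * L) * (b2 * b4).
pose S := 2 * (alpha * L) * (L / mu) * (b2 * b4).
have r0 : 0 <= r by rewrite addr_ge0 // ?mulr_ge0 ?sqr_ge0.
have S0 : 0 <= S by rewrite !mulr_ge0 // invr_ge0.
have [b1t qt] : b1 < t /\ S + r < (t - b1) * (t - (b3 + alpha * b4 * L)).
  apply: (quadratic_gt _ _ _ _ _ _ erefl r0 S0).
  apply: le_lt_trans t2; rewrite le_eqVlt; apply/orP; left; apply/eqP.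
  congr (_ / 2 + Num.sqrt _); last by rewrite /S; ring.
  by congr (_ + Num.sqrt _); [ring|rewrite /r; ring].
have t1' : alpha * mu / 2 < t - (1 - alpha * mu) by lra.
apply: not_eigenvalue_coupled_mx => //; rewrite -/t; try lra.
- by rewrite divr_ge0 // ltW.
- by rewrite !mulr_ge0 ?addr_ge0 // ltW.
- by rewrite mulr_ge0.
- by rewrite addr_ge0 // !mulr_ge0.
- by rewrite !mulr_ge0 ?sqr_ge0.
pose u := t - (1 - alpha * mu); rewrite -/u in t1' *.
have u0 : 0 < u by lra.
have -> : alpha * b2 * (alpha * L / rn * (rn * alpha * b4 * L ^+ 2) +
     u * (b4 * L * (s + alpha * L))) = (alpha * L) ^+ 3 * (b2 * b4) +
     u * (alpha * L * (s + alpha * L) * (b2 * b4)).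
  by field; rewrite gt_eqF.
rewrite -[X in _ < X]mulrA; apply: le_lt_trans (_ : _ <= u * (S + r)) _; last first.
  by rewrite ltr_pM2l.
rewrite [u * (S + r)]mulrDr lerD //.
  (* The factor kappa in S is exactly what cancels mu from alpha mu / 2. *)
  apply: (@le_trans _ _ (alpha * mu / 2 * S)); last by rewrite ler_wpM2r // ltW.
  have -> : alpha * mu / 2 * S = (alpha * L) ^+ 2 * (b2 * b4).
    by rewrite /S; field; rewrite gt_eqF.
  by rewrite ler_wpM2r // exprS ler_piMl ?sqr_ge0.
rewrite ler_pM2l // /r -mulrDl ler_wpM2r //.
have : alpha * L * s <= alpha * L * 2 by rewrite ler_pM2l.
by lra.
Qed.
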